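(* For every integer $a \ge 1$, we have $R(2,a) = a$.
   Context: A finite lattice is graded of rank $3$ if every maximal chain (from bottom to top) has exactly four elements; its elements then lie on four levels: the bottom, the atoms (elements covering the bottom), the coatoms (elements covered by the top), and the top. For integers $c, a \ge 1$, $R(c,a)$ denotes the number of unlabeled graded lattices of rank $3$ (that is, the number of isomorphism classes of such lattices) with exactly $c$ coatoms and exactly $a$ atoms. *)

(* Defs.v *)
From mathcomp Require Import boolp.
From mathcomp Require Import all_boot all_order all_fingroup.

Set Implicit Arguments.
Unset Strict Implicit.
Unset Printing Implicit Defensive.

Import Order.TTheory.
Local Open Scope order_scope.

Section Rank3.
Context {d : Order.disp_t} (L : finTBLatticeType d).

Definition covers (x y : L) : bool :=
  (x < y) && [forall z, ~~ ((x < z) && (z < y))].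

Definition atoms : {set L} := [set x | covers \bot x].

Definition coatoms : {set L} := [set x | covers x \top].

Definition is_chain (C : {set L}) : bool :=
  [forall x in C, forall y in C, x >=< y].

(* A maximal chain automatically contains \bot and \top. *)
Definition graded_rank3 : Prop :=
  forall C : {set L}, maxset is_chain C -> #|C| = 4.

End Rank3.

Arguments atoms {d} L.
Arguments coatoms {d} L.
Arguments graded_rank3 {d} L.

(* The inverse of an order isomorphism is monotone too, and both preserve
   meets and joins, so this is the same as isomorphism of lattices. *)
Definition lattice_iso {d d' : Order.disp_t}
    (L : finTBLatticeType d) (L' : finTBLatticeType d') : Prop :=
  exists2 f : L -> L', bijective f & {mono f : x y / x <= y}.

Definition in_class {d : Order.disp_t} (c a : nat) (L : finTBLatticeType d) :
    Prop :=
  [/\ graded_rank3 L, #|coatoms L| = c & #|atoms L| = a].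

(* The order relation of L, transported to 'I_n along a labeling f. *)
Definition labeled_order {d : Order.disp_t} {L : finTBLatticeType d} {n : nat}
    (f : 'I_n -> L) : {set 'I_n * 'I_n} :=
  [set p | f p.1 <= f p.2].

(* All orders on the label set {0, ..., c + a + 1} that make it a graded lattice
   of rank 3 with c coatoms and a atoms. The number of labels is forced, see
   in_class_card. *)
Definition labeled_lattices (c a : nat) :
    {set {set 'I_(c + a + 2) * 'I_(c + a + 2)}} :=
  [set r | `[< exists (d : Order.disp_t) (L : finTBLatticeType d)
                      (f : 'I_(c + a + 2) -> L),
                 [/\ in_class c a L, bijective f & r = labeled_order f] >]].

Definition relabeling {n : nat} (r r' : {set 'I_n * 'I_n}) : bool :=
  [exists s : 'S_n, forall i, forall j,
     ((s i, s j) \in r') == ((i, j) \in r)].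

(* The number of isomorphism classes; R_transversal restates it without
   labels. *)
Definition R (c a : nat) : nat :=
  #|equivalence_partition relabeling (labeled_lattices c a)|.

Lemma relabelP n (r r' : {set 'I_n * 'I_n}) :
  reflect (exists s : 'S_n, forall i j,
             ((s i, s j) \in r') = ((i, j) \in r))
          (relabeling r r').
Proof.
apply: (iffP existsP) => -[s h]; exists s.
  by move=> i j; have /forallP/(_ j)/eqP := forallP h i.
by apply/forallP=> i; apply/forallP=> j; rewrite h.
Qed.

Lemma relabeling_equiv n :
  {in setT & &, equivalence_rel (@relabeling n)}.
Proof.
have refl : reflexive (@relabeling n).
  by move=> r; apply/relabelP; exists 1%g => i j; rewrite !perm1.
have sym : symmetric (@relabeling n).
  have h r r' : relabeling r r' -> relabeling r' r.
    move=> /relabelP[s h]; apply/relabelP; exists s^-1%g => i j.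
    by rewrite -h !permKV.
  by move=> r r'; apply/idP/idP; exact: h.
have trans : transitive (@relabeling n).
  move=> r2 r1 r3 /relabelP[s h] /relabelP[t k].
  by apply/relabelP; exists (s * t)%g => i j; rewrite -h -k !permM.
move=> x y z _ _ _; split; first exact: refl.
move=> xy; apply/idP/idP; last exact: trans.
by apply: trans; rewrite sym.
Qed.

Lemma relabelingP n d d' (L : finTBLatticeType d) (L' : finTBLatticeType d')
    (f : 'I_n -> L) (f' : 'I_n -> L') :
  bijective f -> bijective f' ->
  relabeling (labeled_order f) (labeled_order f') <-> lattice_iso L L'.
Proof.
move=> [g fK gK] [g' fK' gK']; split.
- move=> /relabelP[s h]; exists (fun x => f' (s (g x))).
    exists (fun y => f ((s^-1)%g (g' y))) => x.
      by rewrite fK' permK gK.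
    by rewrite fK permKV gK'.
  by move=> x y; have := h (g x) (g y); rewrite !inE /= !gK.
- move=> [h [k hK kK] hm].
  have inj : injective (fun i => g' (h (f i))).
    by apply: (can_inj (g := fun i => g (k (f' i)))) => i; rewrite gK' hK fK.
  by apply/relabelP; exists (perm inj) => i j; rewrite !inE /= !permE !gK' hm.
Qed.

Lemma is_chainP d (L : finTBLatticeType d) (C : {set L}) :
  reflect {in C &, forall x y, x >=< y} (is_chain C).
Proof.
apply: (iffP forall_inP) => h x.
  by move=> y xC yC; have /forall_inP := h x xC; apply.
by move=> xC; apply/forall_inP=> y; apply: h.
Qed.

Lemma chain_card d (L : finTBLatticeType d) (s : seq L) :
  graded_rank3 L -> sorted <%O s -> (size s <= 4)%N.
Proof.
move=> gL srt.
have ch : is_chain [set x in s].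
  apply/is_chainP=> x y; rewrite !inE => /(nthP \bot)[i si <-].
  move=> /(nthP \bot)[j sj <-].
  have le := sorted_leq_nth le_trans lexx \bot (sub_sorted (@ltW _ _) srt).
  have [ij|/ltnW ij] := leqP i j.
    by apply: le_comparable; apply: le.
  by apply: ge_comparable; apply: le.
have [C mC sC] := maxset_exists ch.
have us : uniq s by apply: (sorted_uniq lt_trans (@ltxx _ _)).
by rewrite -(card_uniqP us) -(gL C mC) -(cardsE (mem s)); apply: subset_leq_card.
Qed.

Lemma rank3_levels d (L : finTBLatticeType d) (x : L) :
  graded_rank3 L ->
  ((x == \bot) + (x == \top) + (x \in atoms L) + (x \in coatoms L) = 1)%N.
Proof.
move=> gL.
have short (s : seq L) : (4 < size s)%N -> sorted <%O s -> False.
  by move=> s4 /(chain_card gL); rewrite leqNgt s4.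
have ch4 (s : seq L) : sorted <%O s -> (size s < 4)%N ->
    exists2 z, z \notin s & {in s, forall y, z >=< y}.
  move=> srt s4.
  have us : uniq s by apply: (sorted_uniq lt_trans (@ltxx _ _)).
  have [|] := boolP [exists z, (z \notin s) && all (fun y => z >=< y) s].
    by move=> /existsP[z /andP[zs /allP h]]; exists z.
  rewrite negb_exists => /forallP h.
  have le := sorted_leq_nth le_trans lexx \bot (sub_sorted (@ltW _ _) srt).
  suff /gL cs : maxset (@is_chain _ L) [set y in s].
    by move: s4; rewrite -(card_uniqP us) -(cardsE (mem s)) cs.
  apply/maxsetP; split=> [|B /is_chainP chB sB].
    apply/is_chainP=> u v; rewrite !inE => /(nthP \bot)[i si <-].
    move=> /(nthP \bot)[j sj <-].
    have [ij|/ltnW ij] := leqP i j.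
      by apply: le_comparable; apply: le.
    by apply: ge_comparable; apply: le.
  apply/eqP; rewrite eq_sym eqEsubset sB /=; apply/subsetP=> z zB.
  rewrite inE; apply: contraT => zs; have := h z; rewrite zs /= => /allP[] y ys.
  by apply: chB => //; apply: (subsetP sB); rewrite inE.
have bt : (\bot : L) < \top.
  rewrite lt_def le0x andbT; apply/eqP => e.
  have [||z zs _] := ch4 [:: (\bot : L)] => //.
  case/negP: zs; rewrite inE; apply/eqP/le_anti.
  by rewrite le0x -e lex1.
rewrite !inE /covers.
have [->|xb] := eqVneq x \bot.
  rewrite ltxx /= (lt_eqF bt) bt /=.
  case: forallP => // h; have [|//|z] := ch4 [:: \bot; \top : L].
    by rewrite /= bt.
  rewrite !inE negb_or => /andP[zb zt] _; have := h z.
  by rewrite !lt_def le0x lex1 zb eq_sym zt.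
have [->|xt] := eqVneq x \top.
  rewrite ltxx /= bt /=.
  case: forallP => // h; have [|//|z] := ch4 [:: \bot; \top : L].
    by rewrite /= bt.
  rewrite !inE negb_or => /andP[zb zt] _; have := h z.
  by rewrite !lt_def le0x lex1 zb eq_sym zt.
have b_x : \bot < x by rewrite lt_def le0x xb.
have x_t : x < \top by rewrite lt_def lex1 eq_sym xt.
rewrite b_x x_t /=.
case: forallP => ha; case: forallP => hc //; exfalso.
  have [|//|z] := ch4 [:: \bot; x; \top].
    by rewrite /= b_x x_t.
  rewrite !inE !negb_or => /and3P[zb zx zt] /(_ x); rewrite !inE eqxx orbT.
  move=> /(_ isT) /comparable_ltgtP[l|l|/eqP]; last by rewrite (negPf zx).
    by have := ha z; rewrite l lt_def le0x zb.
  by have := hc z; rewrite l lt_def lex1 eq_sym zt.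
have [|y] := boolP [exists y, (\bot < y) && (y < x)]; last first.
  by apply: ha => z; move: y; rewrite negb_exists => /forallP/(_ z).
have [|z] := boolP [exists z, (x < z) && (z < \top)]; last first.
  by move=> _; apply: hc => y; move: z; rewrite negb_exists => /forallP/(_ y).
move=> /existsP[z /andP[xz zt]] /existsP[y /andP[b_y yx]].
by apply: (short [:: \bot; y; x; z; \top]) => //=; rewrite b_y yx xz zt.
Qed.

Lemma in_class_card c a d (L : finTBLatticeType d) :
  in_class c a L -> #|L| = (c + a + 2)%N.
Proof.
move=> [gL <- <-]; rewrite -[LHS]sum1_card.
rewrite (eq_bigr (fun x : L => (x == \bot) + (x == \top) + (x \in atoms L)
   + (x \in coatoms L))%N); last by move=> x _; rewrite rank3_levels.
have count (A : {set L}) : (\sum_x (x \in A) = #|A|)%N.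
  by rewrite -sum1_card [RHS]big_mkcond; apply: eq_bigr => x _; case: (x \in A).
have count1 (y : L) : (\sum_x (x == y) = 1)%N.
  by rewrite -(cards1 y) -count; apply: eq_bigr => x _; rewrite inE.
rewrite !big_split /= !count !count1.
by rewrite -addnA addnC [(#|coatoms L| + _)%N]addnC.
Qed.

Lemma in_class_labeled c a d (L : finTBLatticeType d) :
  in_class c a L ->
  exists2 f : 'I_(c + a + 2) -> L, bijective f &
    labeled_order f \in labeled_lattices c a.
Proof.
move=> cL; have e := in_class_card cL.
pose f i : L := enum_val (cast_ord (esym e) i).
have bf : bijective f.
  exists (fun x => cast_ord e (enum_rank x)) => x.
    by rewrite enum_valK cast_ordKV.
  by rewrite /f cast_ordK enum_rankK.
exists f => //.
by rewrite inE; apply/asboolP; exists d, L, f; split.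
Qed.

Lemma R_transversal c a :
  exists F : 'I_(R c a) -> {d : Order.disp_t & finTBLatticeType d},
    [/\ forall i, in_class c a (projT2 (F i)),
        forall i j, lattice_iso (projT2 (F i)) (projT2 (F j)) -> i = j &
        forall d (L : finTBLatticeType d), in_class c a L ->
          exists i, lattice_iso L (projT2 (F i))].
Proof.
rewrite /R; set P := equivalence_partition _ _.
pose B i : {set {set 'I_(c + a + 2) * 'I_(c + a + 2)}} := enum_val (i : 'I_#|P|).
have rel0 n (r : {set 'I_n * 'I_n}) : relabeling r r.
  by have [] := relabeling_equiv (in_setT r) (in_setT r) (in_setT r).
have relE n (r1 r2 r3 : {set 'I_n * 'I_n}) : relabeling r1 r2 -> relabeling r1 r3 = relabeling r2 r3.
  by have [_] := relabeling_equiv (in_setT r1) (in_setT r2) (in_setT r3).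
have hB i : exists Lf : {d : Order.disp_t & {L : finTBLatticeType d & 'I_(c + a + 2) -> L}},
   [/\ in_class c a (projT1 (projT2 Lf)), bijective (projT2 (projT2 Lf)) &
    B i = [set r in labeled_lattices c a |
             relabeling (labeled_order (projT2 (projT2 Lf))) r]].
  have /imsetP[r rl ->] : B i \in P by exact: enum_valP.
  move: (rl); rewrite inE => /asboolP[d [L [f [cL bf ->]]]].
  by exists (existT _ d (existT _ L f)).
have [F hF] := choice hB.
exists (fun i => existT _ (projT1 (F i)) (projT1 (projT2 (F i)))); split=> /=.
- by move=> i; have [] := hF i.
- move=> i j; have [_ bi ei] := hF i; have [_ bj ej] := hF j.
  move=> /(relabelingP bi bj) rij; apply: enum_val_inj; rewrite -/(B i) -/(B j).
  by rewrite ei ej; apply/setP=> r; rewrite !inE (relE _ _ _ _ rij).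
- move=> d L /in_class_labeled[f bf fl].
  have BP : [set r in labeled_lattices c a | relabeling (labeled_order f) r] \in P.
    by apply/imsetP; exists (labeled_order f).
  exists (enum_rank_in BP [set r in labeled_lattices c a |
                             relabeling (labeled_order f) r]).
  set i := enum_rank_in _ _; have [_ bi ei] := hF i.
  apply/(relabelingP bf bi).
  have : labeled_order (projT2 (projT2 (F i))) \in B i.
    rewrite ei inE rel0 andbT; move: (hF i) => [ci _ _].
    rewrite inE; apply/asboolP.
    by exists (projT1 (F i)), (projT1 (projT2 (F i))), (projT2 (projT2 (F i))).
  by rewrite /B enum_rankK_in // inE => /andP[].
Qed.

(* Main.v *)
(* Let the coatoms be c and e, with x and y atoms below them, x >= y. Every atom
   lies below c or e, both x and y are positive, and the number m of atoms below
   both is at most 1, since such an atom must be the meet of c and e. From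
   x + y = a + m, the difference delta = x - y satisfies 0 <= delta < a, and
   delta determines m by parity, hence x and y, hence the lattice. Conversely,
   each such delta occurs, and delta is an isomorphism invariant. *)

Require Import Defs.
From mathcomp Require Import all_boot.
From HB Require Import structures.
From mathcomp Require Import boolp all_order.
From mathcomp Require Import zify.

Set Implicit Arguments.
Unset Strict Implicit.
Unset Printing Implicit Defensive.

Import Order.TTheory.

(* For k = a + delta, the first x = uphalf k atoms lie below [Coatom true] and
   the last y = a - k./2 lie below [Coatom false]. *)
Inductive model (a k : nat) : Type :=
  Bot | Atom of 'I_a | Coatom of bool | Top.

Arguments Bot {a k}.
Arguments Atom {a k}.
Arguments Coatom {a k}.
Arguments Top {a k}.

(** * Meets and joins in the model *)

Section Model.
Local Open Scope order_scope.
Variables a k : nat.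
Implicit Types (i : 'I_a) (b : bool) (x y z : model a k).

(** The two index ranges cover all atoms. They are disjoint for even [k], and for odd [k] they can
    share only the index [k./2]. *)
Definition below i b : bool := if b then (i < uphalf k)%N else (k./2 <= i)%N.

Definition model_code x : option (option ('I_a + bool)) :=
  match x with
  | Bot => None
  | Top => Some None
  | Atom i => Some (Some (inl i))
  | Coatom b => Some (Some (inr b))
  end.

Definition model_decode (o : option (option ('I_a + bool))) : model a k :=
  match o with
  | None => Bot
  | Some None => Top
  | Some (Some (inl i)) => Atom i
  | Some (Some (inr b)) => Coatom b
  end.

Lemma model_codeK : cancel model_code model_decode.
Proof. by case. Qed.

HB.instance Definition _ := Finite.copy (model a k) (can_type model_codeK).

Lemma model_eqE x y : (x == y) = match x, y with
  | Bot, Bot => true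
  | Atom i, Atom j => i == j
  | Coatom b, Coatom c => b == c
  | Top, Top => true
  | _, _ => false
  end.
Proof. by case: x y => [|i|b|] [|j|c|]. Qed.

Definition model_le x y : bool :=
  match x, y with
  | Bot, _ => true
  | _, Top => true
  | Atom i, Atom j => i == j
  | Atom i, Coatom b => below i b
  | Coatom b, Coatom c => b == c
  | _, _ => false
  end.

(** For incomparable elements, [model_atom_unique] leaves at most one candidate, so the choice made
    by [pick] is forced. The join below is dual. *)
Definition model_meet x y : model a k :=
  if model_le x y then x else if model_le y x then y else
  if [pick i | model_le (Atom i) x && model_le (Atom i) y] is Some i
  then Atom i else Bot.

Definition model_join x y : model a k :=
  if model_le x y then y else if model_le y x then x else
  if [pick b | model_le x (Coatom b) && model_le y (Coatom b)] is Some b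
  then Coatom b else Top.

(* [k./2] and [uphalf k] differ by at most one. *)
Lemma below_both i j : below i true -> below i false ->
  below j true -> below j false -> i = j.
Proof. by rewrite /below => *; apply: val_inj => /=; lia. Qed.

Lemma model_le_refl : reflexive model_le.
Proof. by case=> /=. Qed.

Lemma model_le_anti : antisymmetric model_le.
Proof.
by move=> [|i|b|] [|j|c|] //= /andP[] // /eqP->.
Qed.

Lemma model_le_trans : transitive model_le.
Proof.
by move=> [|i|b|] [|j|c|] [|l|e|] //= => [/eqP->|/eqP->|jb /eqP<-|/eqP->].
Qed.

(** If [x] or [y] is an atom, nothing but that atom can be the common one. Two distinct coatoms are
    handled by [below_both]. *)
Lemma model_atom_unique x y i j :
  model_le x y = false -> model_le y x = false ->
  model_le (Atom i) x -> model_le (Atom i) y ->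
  model_le (Atom j) x -> model_le (Atom j) y -> i = j.
Proof.
case: x y => [|l|b|] [|m|c|] //= _; rewrite ?eqxx //.
- by move=> _ /eqP-> _ /eqP->.
- by move=> _ /eqP-> _ /eqP->.
- by move=> _ _ /eqP-> _ /eqP->.
by case: b c => -[] // _ *; apply: below_both.
Qed.

(** If [x] and [y] are atoms and [b] differs from [c], then both atoms lie below both coatoms, so
    they coincide by [below_both] and are comparable. *)
Lemma model_coatom_unique x y b c :
  model_le x y = false -> model_le y x = false ->
  model_le x (Coatom b) -> model_le y (Coatom b) ->
  model_le x (Coatom c) -> model_le y (Coatom c) -> b = c.
Proof.
case: x y => [|l|e|] [|m|f|] //=.
- by case: b c => -[] //= /eqP lm _ *; case: lm; apply: below_both.
- by move=> _ _ _ /eqP<- _ /eqP.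
- by move=> _ _ /eqP<- _ /eqP->.
by move=> _ _ /eqP<- _ /eqP->.
Qed.

(** Only the coatom itself and [Top] lie above a coatom. Hence incomparable elements have no coatom
    as a common lower bound. *)
Lemma model_above_coatom b x y : model_le (Coatom b) x ->
  model_le (Coatom b) y -> model_le x y || model_le y x.
Proof. by case: x y => [|i|c|] [|j|e|] //= /eqP<- /eqP<-; rewrite eqxx. Qed.

Lemma model_below_atom i x y : model_le x (Atom i) ->
  model_le y (Atom i) -> model_le x y || model_le y x.
Proof. by case: x y => [|j|c|] [|l|e|] //= /eqP-> /eqP->; rewrite eqxx. Qed.

Lemma model_meetP x y z :
  model_le x (model_meet y z) = model_le x y && model_le x z.
Proof.
rewrite /model_meet; case: ifP => yz.
  apply/idP/andP => [xy|[]//]; split=> //; exact: model_le_trans yz.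
case: ifP => zy.
  apply/idP/andP => [xz|[]//]; split=> //; exact: model_le_trans zy.
case: pickP => [i /andP[iy iz]|no].
  apply/idP/andP => [xi|[]].
    by split; apply: (model_le_trans xi).
  (* An atom [x] is the picked one by uniqueness; a coatom or [Top] below both [y] and [z] would
     make them comparable. *)
  case: x => [|j|b|] //= jy jz.
    by apply/eqP; apply: (model_atom_unique yz zy).
    by have := model_above_coatom jy jz; rewrite yz zy.
  by case: y z yz zy jy jz {iy iz} => [|l|c|] [|m|e|].
apply/idP/andP => [|[]]; first by case: x.
case: x => [|j|b|] //= jy jz.
- by move/negbT/negP: (no j); case; apply/andP.
- by have := model_above_coatom jy jz; rewrite yz zy.
- by case: y z yz zy jy jz {no} => [|l|c|] [|m|e|].
Qed.

Lemma model_joinP x y z :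
  model_le (model_join x y) z = model_le x z && model_le y z.
Proof.
rewrite /model_join; case: ifP => xy.
  apply/idP/andP => [yz|[]//]; split=> //; exact: model_le_trans yz.
case: ifP => yx.
  apply/idP/andP => [xz|[]//]; split=> //; exact: model_le_trans xz.
case: pickP => [b /andP[xb yb]|no].
  apply/idP/andP => [bz|[]].
    by split; [apply: (model_le_trans xb)|apply: (model_le_trans yb)].
  case: z => [|j|c|] //= xc yc.
  - by case: x y xy yx xc yc {xb yb} => [|l|c|] [|m|e|].
  - by have := model_below_atom xc yc; rewrite xy yx.
  - by apply/eqP; apply: (model_coatom_unique xy yx).
apply/idP/andP => [|[]]; first by case: z => //; case: x {xy yx no}; case: y.
case: z => [|j|b|] //= xc yc; last by move/negbT/negP: (no b); case; apply/andP.
  by case: x y xy yx xc yc {no} => [|l|c|] [|m|e|].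
by have := model_below_atom xc yc; rewrite xy yx.
Qed.

Lemma model_le0x x : model_le Bot x.
Proof. by []. Qed.

Lemma model_lex1 x : model_le x Top.
Proof. by case: x. Qed.

End Model.

Fact model_display : Order.disp_t. Proof. exact: Order.Disp tt tt. Qed.

HB.instance Definition _ a k := Order.Le_isPOrder.Build
  model_display (model a k) (@model_le_refl a k)
  (@model_le_anti a k) (@model_le_trans a k).
HB.instance Definition _ a k := Order.POrder_MeetJoin_isLattice.Build
  model_display (model a k) (@model_meetP a k) (@model_joinP a k).
HB.instance Definition _ a k := Order.hasBottom.Build
  model_display (model a k) (@model_le0x a k).
HB.instance Definition _ a k := Order.hasTop.Build
  model_display (model a k) (@model_lex1 a k).

(** * The model as a graded lattice of rank 3 *)

Section ModelClass.
Local Open Scope order_scope.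
Variables a k : nat.
Implicit Types (i : 'I_a) (b : bool) (x y z : model a k).

Lemma model_leE x y : (x <= y) = model_le x y.
Proof. by []. Qed.

Lemma model_ltE x y : (x < y) = (y != x) && model_le x y.
Proof. exact: lt_def. Qed.

Lemma below_some_coatom i : exists b, below k i b.
Proof.
have [|] := ltnP i (uphalf k); first by exists true.
by move=> ki; exists false; rewrite /below; lia.
Qed.

Hypothesis (k_gt0 : (0 < k)%N) (k_lt : (k < a.*2)%N).

(** The bounds on [k] say that [0 < uphalf k] and [k./2 < a], which puts the first atom below
    [Coatom true] and the last one below [Coatom false]. *)
Lemma some_atom_below b : exists i, below k i b.
Proof.
case: b.
  by have a0 : (0 < a)%N by [lia]; exists (Ordinal a0); rewrite /below /=; lia.
have a1 : (a.-1 < a)%N by lia.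
by exists (Ordinal a1); rewrite /below /=; lia.
Qed.

Lemma model_atoms : atoms (model a k) = [set Atom i | i : 'I_a].
Proof.
apply/setP => x; rewrite inE /covers; apply/idP/imsetP.
  case: x => [|i|b|] /andP[]; rewrite ?ltxx // => _ /forallP h.
  - by exists i.
  - have [i ib] := some_atom_below b.
    by have := h (Atom i); rewrite !model_ltE /= ib.
  - by have := h (Coatom true).
move=> [i _ ->]; apply/andP; split=> //; apply/forallP => z.
by case: z => // j; rewrite !model_ltE /= model_eqE eq_sym; case: eqP.
Qed.

Lemma model_coatoms : coatoms (model a k) = [set Coatom b | b : bool].
Proof.
apply/setP => x; rewrite inE /covers; apply/idP/imsetP.
  case: x => [|i|b|] /andP[]; rewrite ?ltxx // => _ /forallP h.
  - by have := h (Coatom true).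
  - have [b ib] := below_some_coatom i.
    by have := h (Coatom b); rewrite !model_ltE /= ib.
  - by exists b.
move=> [b _ ->]; apply/andP; split=> //; apply/forallP => z.
by case: z => // c; rewrite !model_ltE /= model_eqE eq_sym; case: eqP.
Qed.

Lemma Atom_inj : injective (@Atom a k).
Proof. by move=> i j []. Qed.

Lemma Coatom_inj : injective (@Coatom a k).
Proof. by move=> b c []. Qed.

(** A chain has at most one atom and at most one coatom, so it is contained in a chain [D] with one
    element on each level. A maximal chain equals this [D]. *)
Lemma model_graded : graded_rank3 (model a k).
Proof.
move=> C /maxsetP[/is_chainP chC maxC].
have comp x y : x \in C -> y \in C -> model_le x y || model_le y x.
  by move=> xC yC; have := chC _ _ xC yC.
have atomC i j : Atom i \in C -> Atom j \in C -> i = j.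
  by move=> iC jC; have /orP[|] := comp _ _ iC jC => /eqP.
have coatomC b c : Coatom b \in C -> Coatom c \in C -> b = c.
  by move=> bC cC; have /orP[|] := comp _ _ bC cC => /eqP.
(* A level missing from [C] is filled by a coatom above the given atom or an atom below the given
   coatom; if both are missing, [Coatom true] is the starting point. *)
have [i [b [ib Ci Cb]]] : exists i b, [/\ below k i b,
    forall j, Atom j \in C -> j = i & forall c, Coatom c \in C -> c = b].
  case: (pickP (fun i => Atom i \in C)) => [i iC|noA];
  case: (pickP (fun b => Coatom b \in C)) => [b bC|noC].
  - exists i, b; split=> [|j jC|c cC]; [|exact: atomC|exact: coatomC].
    by have := comp _ _ iC bC; rewrite /= orbF.
  - have [b ib] := below_some_coatom i; exists i, b.
    by split=> // [j jC|c]; [exact: atomC|rewrite noC].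
  - have [i ib] := some_atom_below b; exists i, b.
    by split=> // [j|c cC]; [rewrite noA|exact: coatomC].
  - have [i ib] := some_atom_below true; exists i, true.
    by split=> // [j|c]; [rewrite noA|rewrite noC].
pose D : {set model a k} := [set x in [:: Bot; Atom i; Coatom b; Top]].
have <- : D = C.
  apply: maxC.
    apply/is_chainP => x y; rewrite !inE /Order.comparable !model_leE.
    by do 2![case/or4P => /eqP->]; rewrite /= ?eqxx ?ib.
  apply/subsetP => -[|j|c|] xC; rewrite !inE //.
  - by rewrite (Ci _ xC) eqxx ?orbT.
  - by rewrite (Cb _ xC) eqxx ?orbT.
by rewrite cardsE; apply/card_uniqP.
Qed.

Lemma model_in_class : in_class 2 a (model a k).
Proof.
split; first exact: model_graded.
  by rewrite model_coatoms card_imset ?card_bool //; apply: Coatom_inj.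
by rewrite model_atoms card_imset ?card_ord //; apply: Atom_inj.
Qed.

Lemma card_below b :
  #|[set i : 'I_a | below k i b]| = if b then uphalf k else (a - k./2)%N.
Proof.
have widen_inj s (sa : (s <= a)%N) : injective (widen_ord sa).
  by move=> i j [] /val_inj.
have ltE s : (s <= a)%N -> #|[set i : 'I_a | (i < s)%N]| = s.
  move=> sa; rewrite -[RHS]card_ord -cardsT -(card_imset _ (widen_inj s sa)).
  apply: eq_card => i; rewrite inE; 
  apply/idP/imsetP => [si|[j _ ->]]; last exact: (ltn_ord j).
  by exists (Ordinal si); last apply: val_inj.
case: b; first by apply: ltE; lia.
have -> : [set i | below k i false] = ~: [set i : 'I_a | (i < k./2)%N].
  by apply/setP => i; rewrite !inE -leqNgt.
rewrite cardsCs setCK card_ord; congr (_ - _)%N; apply: ltE; lia.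
Qed.

(** The added 2 counts [Bot] and the coatom itself. *)
Lemma model_downset b :
  #|[set x : model a k | x <= Coatom b]| =
    (if b then uphalf k else a - k./2).+2%N.
Proof.
rewrite -card_below.
have -> : [set x : model a k | x <= Coatom b] =
    Bot |: (Coatom b |: [set Atom i | i in [set i : 'I_a | below k i b]]).
  apply/setP => x; rewrite !inE model_leE; apply/idP/or3P.
    case: x => [|i|c|] //=.
    - by constructor 1.
    - by move=> ib; constructor 3; rewrite mem_imset ?inE //; apply: Atom_inj.
    - by move=> /eqP ->; constructor 2.
  by case=> [/eqP->|/eqP->|/imsetP[i + ->]]; rewrite ?inE //=.
rewrite !cardsU1 card_imset; last exact: Atom_inj.
rewrite !inE; do 2!case: imsetP => [[] //|_].
by rewrite orbF.
Qed.

End ModelClass.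

(** * The invariant delta *)

Section Spread.
Local Open Scope order_scope.

(* This is delta: a downset consists of \bot, the coatom and the atoms below it,
   and truncated subtraction makes the maximum an absolute difference. *)
Definition spread d (L : finTBLatticeType d) : nat :=
  (\max_(x in coatoms L) \max_(y in coatoms L)
     (#|[set z | (z <= x)%O]| - #|[set z | (z <= y)%O]|))%N.

Lemma lattice_iso_sym d d' (L : finTBLatticeType d) (L' : finTBLatticeType d') :
  lattice_iso L L' -> lattice_iso L' L.
Proof.
move=> [f [g fK gK] fm]; exists g; first by exists f.
by move=> x y; rewrite -fm !gK.
Qed.

Lemma lattice_iso_trans d1 d2 d3 (L1 : finTBLatticeType d1)
    (L2 : finTBLatticeType d2) (L3 : finTBLatticeType d3) :
  lattice_iso L1 L2 -> lattice_iso L2 L3 -> lattice_iso L1 L3.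
Proof.
move=> [f fb fm] [g gb gm]; exists (g \o f); first exact: bij_comp.
by move=> x y; rewrite /= gm fm.
Qed.

(** An isomorphism maps coatoms onto coatoms and each downset onto the downset of the image, so both
    maxima run over the same values. *)
Lemma spread_iso d d' (L : finTBLatticeType d) (L' : finTBLatticeType d') :
  lattice_iso L L' -> spread L = spread L'.
Proof.
move=> [f bf fm]; have fi := bij_inj bf; have [g fK gK] := bf.
have imE (A : {set L}) (B : {set L'}) : (forall x, (f x \in B) = (x \in A)) ->
    B = f @: A.
  move=> h; apply/setP => y; apply/idP/imsetP => [yB|[x xA ->]].
    by exists (g y); rewrite ?gK // -h gK.
  by rewrite h.
have fl : {mono f : x y / x < y} by apply: leW_mono.
have ft : f \top = \top by apply: le_anti; rewrite lex1 -[\top]gK fm lex1.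
have fc : coatoms L' = f @: coatoms L.
  apply: imE => x; rewrite !inE /covers -ft fl; congr andb.
  apply/forallP/forallP => h z; first by rewrite -!fl.
  by rewrite -[z]gK !fl.
have fd x : #|[set z | z <= f x]| = #|[set z | z <= x]|.
  rewrite -(card_imset _ fi); congr #|pred_of_set _|.
  by apply: imE => z; rewrite !inE fm.
rewrite /spread fc big_imset /=; last by move=> x y _ _; apply: fi.
apply: eq_bigr => x _; rewrite big_imset /=; last by move=> ? ? _ _; apply: fi.
by apply: eq_bigr => y _; rewrite !fd.
Qed.

(** With [k = a + delta], the downset sizes differ by [uphalf k - (a - k./2) = k - a]; the other
    differences are truncated to 0. *)
Lemma spread_model a (delta : 'I_a) : spread (model a (a + delta)) = delta.
Proof.
have la := ltn_ord delta.
have [k0 k1] : (0 < a + delta)%N /\ (a + delta < a.*2)%N by split; lia.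
rewrite /spread model_coatoms // big_imset /=; last by move=> ? ? _ _ [].
rewrite big_bool /= !big_imset /=; do ?by move=> ? ? _ _ [].
rewrite !big_bool /= !model_downset //=; lia.
Qed.

End Spread.

(** * Atoms and coatoms of a graded lattice of rank 3 *)

Section Rank3.
Local Open Scope order_scope.
Context {d : Order.disp_t} (L : finTBLatticeType d).
Implicit Types (p q c x y : L).

Lemma le_atom p x : p \in atoms L -> (x <= p) = (x == \bot) || (x == p).
Proof.
rewrite inE => /andP[p0 /forallP h]; have := h x.
rewrite lt0x [x < p]lt_neqAle; case: eqVneq => [->|_] /=; first by rewrite le0x.
by case: eqVneq => [->|_] /=; [rewrite lexx|move/negPf].
Qed.

Lemma coatom_le c x : c \in coatoms L -> (c <= x) = (x == \top) || (x == c).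
Proof.
rewrite inE => /andP[c1 /forallP h]; have := h x.
rewrite ltx1 lt_neqAle andbC; case: eqVneq => [->|_] /=; first by rewrite lex1.
by rewrite eq_sym; case: eqVneq => [->|_] /=; [rewrite lexx|move/negPf].
Qed.

Hypothesis gL : graded_rank3 L.

(** The four indicators in [rank3_levels] sum to 1, so no two of them hold together; [levelP] uses
    that one of them holds. *)
Lemma level_distinct :
  [/\ (\bot : L) == \top = false,
     forall p, p \in atoms L ->
       [/\ p == \bot = false, p == \top = false & p \in coatoms L = false] &
     forall c, c \in coatoms L ->
       [/\ c == \bot = false, c == \top = false & c \in atoms L = false]].
Proof.
split.
- by have := rank3_levels \bot gL; rewrite eqxx; case: (_ == _).
- move=> p pA; have := rank3_levels p gL; rewrite pA.
  by case: (p == _) (p == _) (_ \in _) => [] [] [].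
- move=> c cA; have := rank3_levels c gL; rewrite cA.
  by case: (c == _) (c == _) (_ \in _) => [] [] [].
Qed.

Lemma between x y : x < y -> ~~ covers x y -> exists2 z, x < z & z < y.
Proof.
by rewrite /covers => -> /= /forallPn[z] /negPn/andP[]; exists z.
Qed.

Lemma levelP x : [\/ x = \bot, x = \top, x \in atoms L | x \in coatoms L].
Proof.
have := rank3_levels x gL.
case: eqVneq => [->|_] lev; first by constructor 1.
move: lev; case: eqVneq => [->|_] lev; first by constructor 2.
move: lev; case: (boolP (x \in atoms L)) => [xA|_] lev; first by constructor 3.
by constructor 4; case: (x \in coatoms L) lev.
Qed.

(** Since [p] is not a coatom, some [z] lies strictly between [p] and the top. It is not an atom,
    because distinct atoms are incomparable, so it is a coatom. *)
Lemma coatom_above p : p \in atoms L -> exists2 c, c \in coatoms L & p <= c.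
Proof.
have [_ lA lC] := level_distinct => pA; have [p0 p1 pC] := lA _ pA.
have [||z pz z1] := @between p \top.
- by rewrite ltx1 p1.
- by move: pC; rewrite inE => ->.
exists z; last exact: ltW.
have [e|e|zA|//] := levelP z.
- by move: pz; rewrite e ltx0.
- by move: z1; rewrite e ltxx.
have := ltW pz; rewrite (le_atom _ zA) p0 /= => /eqP e.
by move: pz; rewrite e ltxx.
Qed.

Lemma atom_below c : c \in coatoms L -> exists2 p, p \in atoms L & p <= c.
Proof.
have [_ lA lC] := level_distinct => cC; have [c0 c1 cA] := lC _ cC.
have [||z z0 zc] := @between \bot c.
- by rewrite lt0x c0.
- by move: cA; rewrite inE => ->.
exists z; last exact: ltW.
have [e|e|//|zC] := levelP z.
- by move: z0; rewrite e ltxx.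
- by move: zc; rewrite e lt1x.
have := ltW zc; rewrite (coatom_le _ zC) c1 /= => /eqP e.
by move: zc; rewrite e ltxx.
Qed.

(** The meet of [c] and [e] lies above [p] and [q]. It is not the bottom or the top, and as a coatom
    it would equal both [c] and [e]; so it is an atom, equal to [p] and to [q]. *)
Lemma common_atom p q c e : p \in atoms L -> q \in atoms L ->
  c \in coatoms L -> e \in coatoms L -> c != e ->
  p <= c -> p <= e -> q <= c -> q <= e -> p = q.
Proof.
have [_ lA lC] := level_distinct => pA qA cC eC ce pc pe qc qe.
have [p0 _ _] := lA _ pA; have [q0 _ _] := lA _ qA.
have [_ c1 _] := lC _ cC; have [_ e1 _] := lC _ eC.
have : p <= c `&` e by rewrite lexI pc.
have : q <= c `&` e by rewrite lexI qc.
have [->|h|zA|zC] := levelP (c `&` e).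
- by rewrite !lex0 p0.
- by have := leIl c e; rewrite h le1x c1.
- by rewrite !(le_atom _ zA) p0 q0 => /eqP-> /eqP->.
case/eqP: ce; have := coatom_le c zC; rewrite leIl c1 => /esym/eqP ->.
by have := coatom_le e zC; rewrite leIr e1 => /esym/eqP <-.
Qed.

End Rank3.

(** * Every lattice of the class is a model *)

Section Classification.
Local Open Scope order_scope.

(** The parity argument: [a + (x - y) = 2x - m] with [m] at most 1, so the two halves recover [x]
    and [x - m]. *)
Lemma halves_add_diff a x y m :
  (m <= 1 -> m <= x -> x + y = a + m -> y <= x ->
   uphalf (a + (x - y)) = x /\ (a + (x - y))./2 = x - m)%N.
Proof.
move=> m1 mx xy yx; have -> : (a + (x - y) = x.*2 - m)%N by lia.
by split; lia.
Qed.

(** No entry of [s2] occurs in [s1], so position decides membership. This turns lying below a coatom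
    into a bound on the index. *)
Lemma nth_in_prefix (T : eqType) (x0 : T) (s1 s2 : seq T) (i : nat) :
  uniq (s1 ++ s2) -> (i < size (s1 ++ s2))%N ->
  (nth x0 (s1 ++ s2) i \in s1) = (i < size s1)%N.
Proof.
rewrite cat_uniq size_cat => /and3P[_ /hasPn s2N _] i_lt; rewrite nth_cat.
case: ltnP => i1; first exact: mem_nth.
by apply/negbTE/s2N/mem_nth; rewrite ltn_subLR.
Qed.

Lemma iso_model a d (L : finTBLatticeType d) : in_class 2 a L ->
  exists delta : 'I_a, lattice_iso (model a (a + delta)) L.
Proof.
move=> cL; have cardL := in_class_card cL.
case: cL => gL /eqP/cards2P[c0 [e0 [ce0 coE0]]] cA.
pose under (x : L) := [set p in atoms L | p <= x].
have underE x q : (q \in under x) = (q \in atoms L) && (q <= x).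
  by rewrite /under in_set.
(* The coatoms are named so that [c], with at least as many atoms, corresponds to [Coatom true]. *)
have [c [e [ce coE eLc]]] : exists c e : L, [/\ c != e, coatoms L = [set c; e] &
    (#|under e| <= #|under c|)%N].
  have [h|h] := leqP #|under e0| #|under c0|; first by exists c0, e0.
  by exists e0, c0; rewrite eq_sym setUC ltnW.
have cC : c \in coatoms L by rewrite coE !inE eqxx.
have eC : e \in coatoms L by rewrite coE !inE eqxx orbT.
have [p pA pe] := atom_below gL eC.
have e_gt0 : (0 < #|under e|)%N by apply/card_gt0P; exists p; rewrite underE pA.
have both : (#|under c :&: under e| <= 1)%N.
  apply/card_le1P => q + r; rewrite !in_setI !underE.
  move=> /andP[/andP[qA qc] /andP[_ qe]].
  apply/idP/eqP => [/andP[/andP[rA rc] /andP[_ re]]|->].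
    exact: (common_atom gL rA qA cC eC).
  by rewrite qA qc qe.
have cover : atoms L = under c :|: under e.
  apply/setP => q; rewrite in_setU !underE -andb_orr.
  case: (boolP (q \in _)) => //= qA.
  have [x] := coatom_above gL qA; rewrite coE !inE => /orP[]/eqP-> ->//.
  by rewrite orbT.
have cardA : (#|under c| + #|under e| = a + #|under c :&: under e|)%N.
  by rewrite -cardsUI -cover cA.
(* Atoms below [c] only come first, then the shared one if any, then those below [e] only. Thus
   [s1 ++ s2] lists the atoms below [c] and [s2 ++ s3] those below [e], as in [below]. *)
pose s1 : seq L := enum (under c :\: under e).
pose s2 : seq L := enum (under c :&: under e).
pose s3 : seq L := enum (under e :\: under c).
pose s := s1 ++ s2 ++ s3.
have [z1 z2 z3] : [/\ size s1 = #|under c| - #|under c :&: under e|,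
    size s2 = #|under c :&: under e| &
    size s3 = #|under e| - #|under c :&: under e|]%N.
  by rewrite -!cardE !cardsD [under e :&: _]setIC.
have leI1 : (#|under c :&: under e| <= #|under c|)%N.
  by apply/subset_leq_card/subsetIl.
have leI2 : (#|under c :&: under e| <= #|under e|)%N.
  by apply/subset_leq_card/subsetIr.
have size_s : size s = a by rewrite !size_cat; lia.
have mem_s : s =i atoms L.
  move=> q; rewrite cover !mem_cat !mem_enum in_setU in_setI !in_setD !underE.
  by case: (q \in atoms L) (q <= c) (q <= e) => [] [] [].
(* A list of length [a] containing all [a] atoms has no repetition. *)
have uniq_s : uniq s.
  apply: (@leq_size_uniq _ (enum (atoms L))); first exact: enum_uniq.
    by move=> q; rewrite mem_enum mem_s.
  by rewrite size_s -cardE cA.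
(* In the notation above, [x - y = a + m - 2y] with [m <= 1] and [y >= 1]. *)
have delta_lt : (#|under c| - #|under e| < a)%N by lia.
exists (Ordinal delta_lt); rewrite /=.
set k := (a + _)%N.
have [k_up k_half] : uphalf k = (size s1 + size s2)%N /\ k./2 = size s1.
  have [up half] := halves_add_diff both leI1 cardA eLc.
  by rewrite /k up half z1 z2 subnK.
have nthA (i : 'I_a) : nth c s i \in atoms L.
  by rewrite -mem_s mem_nth // size_s.
have nthC (i : 'I_a) : (nth c s i <= c) = below k i true.
  rewrite /below k_up -size_cat -(@nth_in_prefix _ c _ s3) -?catA ?size_s //.
  rewrite -/s mem_cat !mem_enum in_setD in_setI !underE nthA /=.
  by rewrite [_ && (_ <= c)]andbC -andb_orr orNb andbT.
(* Since every atom is below [c] or [e], an atom is below [e] exactly when it is outside [s1]. *)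
have nthE (i : 'I_a) : (nth c s i <= e) = below k i false.
  rewrite /below k_half leqNgt -(@nth_in_prefix _ c _ (s2 ++ s3)) ?size_s //.
  rewrite -/s mem_enum in_setD !underE nthA /= negb_and negbK.
  have := nthA i; rewrite cover in_setU !underE nthA /=.
  by case: (_ <= e); case: (_ <= c).
pose F (x : model a k) : L := match x with
  | Bot => \bot | Top => \top | Atom i => nth c s i
  | Coatom b => if b then c else e end.
have [bt lA lC] := level_distinct gL.
have [c_0 c_1 _] := lC _ cC; have [e_0 e_1 _] := lC _ eC.
have tb : (\top == \bot :> L) = false by rewrite eq_sym.
have Fm : {mono F : x y / x <= y}.
  move=> [|i|b|] [|j|b'|]; rewrite model_leE /= ?le0x ?lex1 ?lex0 ?le1x //.
  - by have [-> _ _] := lA _ (nthA i).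
  - rewrite (le_atom _ (nthA j)); have [-> _ _] := lA _ (nthA i).
    by rewrite nth_uniq ?size_s.
  - by case: b'.
  - by case: b.
  - have [_ q1 qC] := lA _ (nthA j).
    case: b; rewrite coatom_le // q1; apply/eqP => qE.
      by rewrite qE cC in qC.
    by rewrite qE eC in qC.
  - case: b b' => -[]; rewrite ?lexx // coatom_le //.
      by rewrite e_1 eq_sym; apply/negbTE.
    by rewrite c_1; apply/negbTE.
  - by have [_ -> _] := lA _ (nthA j).
  - by case: b'.
(* Surjectivity follows by counting: both lattices have [2 + a + 2] elements. *)
have Fi : injective F by apply: inc_inj.
exists F => //; apply: inj_card_bij => //.
have k_gt0 : (0 < k)%N by rewrite addn_gt0 (leq_ltn_trans _ delta_lt).
have k_lt : (k < a.*2)%N by rewrite -addnn ltn_add2l.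
by rewrite cardL (in_class_card (model_in_class k_gt0 k_lt)).
Qed.

End Classification.

(** * Counting the isomorphism classes *)

Theorem theorem4p1 (a : nat) (ha : 1 <= a) : R 2 a = a.
Proof.
have [F [Fin Fiso Fex]] := R_transversal 2 a.
have modelP (delta : 'I_a) : in_class 2 a (model a (a + delta)).
  by have := ltn_ord delta => ?; apply: model_in_class; lia.
(* [G] sends delta to the class of its model. It is injective because [spread] recovers delta, and
   surjective by [iso_model]. *)
have [G Giso] := choice (fun delta => Fex _ _ (modelP delta)).
have Ginj : injective G.
  move=> i j Gij; apply/val_inj; rewrite /= -(spread_model i) -(spread_model j).
  by rewrite (spread_iso (Giso i)) (spread_iso (Giso j)) Gij.
have Gsurj i : exists delta, G delta = i.
  have [delta iso] := iso_model (Fin i); exists delta.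
  by apply/Fiso/(lattice_iso_trans _ iso)/lattice_iso_sym.
have [H HK] := choice Gsurj.
have bijG : bijective G by exists H => // i; apply: Ginj; rewrite HK.
by rewrite -[LHS]card_ord -[RHS]card_ord (bij_eq_card bijG).
Qed.
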